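(* Consider a preconditioned least-squares Petrov--Galerkin (LSPG) reduced-order model (ROM) with a given POD basis $\Phi_M\in\mathbb{R}^{N\times M}$, solved by Gauss--Newton iteration, and suppose it is ''ideal'', i.e. the preconditioner in each Gauss--Newton iteration $k$ is $M^{(k)}=(J^{(k)})^{-1}$, where the Jacobian $J^{(k)}\in\mathbb{R}^{N\times N}$ of the full-order model (FOM) is full rank. Then this ideal preconditioned ROM emulates the projection of the FOM solution increment onto the given POD basis: the ROM solution increment $\delta\tilde w^{(k)}=\Phi_M\,\delta\hat w^{(k)}$ and the FOM solution increment $\delta w^{(k)}=-(J^{(k)})^{-1}r^{(k)}$ satisfy $$\delta\tilde w^{(k)}=\Phi_M\left(\Phi_M^T\Phi_M\right)^{-1}\Phi_M^T\,\delta w^{(k)}.$$ Since this projection is the upper limit on the ROM accuracy given a basis $\Phi_M$ (equivalently, it defines a lower bound on the error of a ROM solution for the given basis), it follows that the most accurate ROM possible is realizable through the introduction of preconditioning.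
   Context: The full-order model (FOM) is a nonlinear algebraic system $r(w)=0$ with state $w\in\mathbb{R}^N$ and residual $r:\mathbb{R}^N\to\mathbb{R}^N$, solved by Newton's method. At iteration $k$, $r^{(k)}\in\mathbb{R}^N$ and $J^{(k)}\in\mathbb{R}^{N\times N}$ denote the residual and the Jacobian $\partial r/\partial w$ evaluated at the current iterate, and the FOM solution increment $\delta w^{(k)}$ is defined by $J^{(k)}\delta w^{(k)}=-r^{(k)}$. A ROM seeks an approximate solution $\tilde w=w_0+\Phi_M\hat w$, where $w_0\in\mathbb{R}^N$ is a fixed reference state, $\hat w\in\mathbb{R}^M$ are generalized coordinates, and the columns of the POD (proper orthogonal decomposition) basis $\Phi_M\in\mathbb{R}^{N\times M}$ are the first $M$ left singular vectors of a matrix of solution snapshots, so that $\Phi_M^T\Phi_M=I$. The preconditioned LSPG ROM solves $\min_{y\in\mathbb{R}^M}\|\mathcal{M}\,r(w_0+\Phi_M y)\|_2^2$, where $\mathcal{M}\in\mathbb{R}^{N\times N}$ is a nonsingular preconditioner, by Gauss--Newton. At iteration $k$, with a nonsingular preconditioner $M^{(k)}\in\mathbb{R}^{N\times N}$ that may change from iteration to iteration (not to be confused with the integer $M$), one computes $$\delta\hat w^{(k)}\in\arg\min_{y\in\mathbb{R}^M}\left\|M^{(k)}\left(J^{(k)}\Phi_M y+r^{(k)}\right)\right\|_2^2$$ and updates $\hat w^{(k)}=\hat w^{(k-1)}+\alpha_k\,\delta\hat w^{(k)}$ with step length $\alpha_k\in\mathbb{R}$. The same $J^{(k)}$ and $r^{(k)}$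 appear in the FOM increment equation and in the ROM least-squares problem. *)

(* Defs.v *)
From HB Require Import structures.
From mathcomp Require Import all_boot all_order all_algebra.
From mathcomp Require Import all_classical all_reals all_analysis.

Set Implicit Arguments.
Unset Strict Implicit.
Unset Printing Implicit Defensive.

Import Order.TTheory GRing.Theory Num.Theory.
Import numFieldNormedType.Exports.

Local Open Scope ring_scope.

(* The norm `|v| that the library puts on 'cV[R]_n is the sup norm. *)
Definition l2norm (R : realType) (n : nat) (v : 'cV[R]_n) : R :=
  Num.sqrt (\sum_i v i 0 ^+ 2).

Definition is_argmin (R : realType) (T : Type) (f : T -> R) (x : T) : Prop :=
  forall y : T, f x <= f y.

(* Full singular value decomposition: Sigma is rectangular, and its diagonal
   entries (the singular values) are nonnegative and in decreasing order. *)
Definition is_SVD (R : realType) (N Ns : nat) (S : 'M[R]_(N, Ns))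
    (U : 'M[R]_N) (Sigma : 'M[R]_(N, Ns)) (V : 'M[R]_Ns) : Prop :=
  [/\ U^T *m U = 1%:M,
      V^T *m V = 1%:M,
      forall (i : 'I_N) (j : 'I_Ns), (i : nat) != j -> Sigma i j = 0,
      (forall (i : 'I_N) (j : 'I_Ns), (i : nat) = j -> 0 <= Sigma i j) /\
      (forall (i i' : 'I_N) (j j' : 'I_Ns),
         (i : nat) = j -> (i' : nat) = j' -> (i <= i')%N -> Sigma i' j' <= Sigma i j)
    & S = U *m Sigma *m V^T].

(* The columns of Phi are the first M left singular vectors of the snapshot
   matrix S, whose columns are the Ns snapshots.  The decomposition need not be
   unique; any one is allowed. *)
Definition is_POD_basis (R : realType) (N M Ns : nat) (S : 'M[R]_(N, Ns))
    (Phi : 'M[R]_(N, M)) : Prop :=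
  exists U Sigma V (leMN : (M <= N)%N),
    is_SVD S U Sigma V /\ Phi = colsub (widen_ord leMN) U.

(* 'J of the library acts on row vectors (v *m 'J f p); here states and
   residuals are columns and J i j = d r_i / d w_j. *)
Definition jacobian_mx (R : realType) (N : nat) (r : 'cV[R]_N -> 'cV[R]_N)
    (w : 'cV[R]_N) : 'M[R]_N :=
  \matrix_(i, j) ('D_(delta_mx j 0) r w) i 0.

Definition fom_increment (R : realType) (N : nat) (r : 'cV[R]_N -> 'cV[R]_N)
    (w : 'cV[R]_N) : 'cV[R]_N :=
  - (invmx (jacobian_mx r w) *m r w).

Definition rom_state (R : realType) (N M : nat) (w0 : 'cV[R]_N)
    (Phi : 'M[R]_(N, M)) (what : 'cV[R]_M) : 'cV[R]_N :=
  w0 + Phi *m what.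

(* The state at which iteration k >= 1 evaluates the residual and Jacobian;
   what k is the vector of generalized coordinates after iteration k. *)
Definition current_iterate (R : realType) (N M : nat) (w0 : 'cV[R]_N)
    (Phi : 'M[R]_(N, M)) (what : nat -> 'cV[R]_M) (k : nat) : 'cV[R]_N :=
  rom_state w0 Phi (what k.-1).

Definition lspg_objective (R : realType) (N M : nat)
    (r : 'cV[R]_N -> 'cV[R]_N) (Phi : 'M[R]_(N, M)) (P : 'M[R]_N)
    (w : 'cV[R]_N) (y : 'cV[R]_M) : R :=
  l2norm (P *m (jacobian_mx r w *m Phi *m y + r w)) ^+ 2.

(* The first K Gauss-Newton iterations of the LSPG ROM, with preconditioner
   P k, step length alpha k and increment dwhat k at iteration k; the initial
   coordinates what 0 are arbitrary. *)
Definition lspg_gauss_newton (R : realType) (N M : nat)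
    (r : 'cV[R]_N -> 'cV[R]_N) (w0 : 'cV[R]_N) (Phi : 'M[R]_(N, M)) (K : nat)
    (P : nat -> 'M[R]_N) (alpha : nat -> R)
    (what dwhat : nat -> 'cV[R]_M) : Prop :=
  forall k : nat, (0 < k <= K)%N ->
    let w := current_iterate w0 Phi what k in
    [/\ differentiable r w,
        P k \in unitmx,
        is_argmin (lspg_objective r Phi (P k) w) (dwhat k)
      & what k = what k.-1 + alpha k *: dwhat k].

Definition ideal_preconditioning (R : realType) (N M : nat)
    (r : 'cV[R]_N -> 'cV[R]_N) (w0 : 'cV[R]_N) (Phi : 'M[R]_(N, M)) (K : nat)
    (P : nat -> 'M[R]_N) (what : nat -> 'cV[R]_M) : Prop :=
  forall k : nat, (0 < k <= K)%N ->
    let J := jacobian_mx r (current_iterate w0 Phi what k) in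
    \rank J = N /\ P k = invmx J.

Definition basis_proj (R : realType) (N M : nat) (Phi : 'M[R]_(N, M)) :
    'M[R]_N :=
  Phi *m invmx (Phi^T *m Phi) *m Phi^T.

(* Main.v *)
Require Import Defs.
From HB Require Import structures.
From mathcomp Require Import all_boot all_order all_algebra.
From mathcomp Require Import all_classical all_reals all_analysis.

Set Implicit Arguments.
Unset Strict Implicit.
Unset Printing Implicit Defensive.

Import Order.TTheory GRing.Theory Num.Theory.
Import numFieldNormedType.Exports.

Local Open Scope ring_scope.

(* With P = J^-1 the Gauss-Newton objective at y is the squared distance from
   Phi y to the FOM increment, so its minimisers are governed by the Pythagorean
   identity for the orthogonal projection onto the column space of Phi. *)

Section LeastSquares.
Variable R : realType.

Lemma l2norm_ge0 n (v : 'cV[R]_n) : 0 <= l2norm v.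
Proof. exact: sqrtr_ge0. Qed.

Lemma l2norm_sqr n (v : 'cV[R]_n) : l2norm v ^+ 2 = (v^T *m v) 0 0.
Proof.
rewrite sqr_sqrtr; last by apply: sumr_ge0 => i _; exact: sqr_ge0.
by rewrite mxE; apply: eq_bigr => i _; rewrite mxE expr2.
Qed.

Lemma l2norm_eq0 n (v : 'cV[R]_n) : l2norm v ^+ 2 <= 0 -> v = 0.
Proof.
rewrite sqr_sqrtr; last by apply: sumr_ge0 => i _; exact: sqr_ge0.
move=> le0; apply/matrixP => i j; rewrite ord1 mxE.
have /psumr_eq0P v0 : \sum_i v i 0 ^+ 2 = 0.
  by apply/le_anti; rewrite le0 sumr_ge0// => k _; exact: sqr_ge0.
by apply/eqP; rewrite -sqrf_eq0 v0// => k _; exact: sqr_ge0.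
Qed.

Lemma l2normN n (v : 'cV[R]_n) : l2norm (- v) = l2norm v.
Proof. by congr Num.sqrt; apply: eq_bigr => i _; rewrite mxE sqrrN. Qed.

Lemma ler_l2norm_sqr m n (u : 'cV[R]_m) (v : 'cV[R]_n) :
  (l2norm u ^+ 2 <= l2norm v ^+ 2) = (l2norm u <= l2norm v).
Proof. by rewrite ler_sqr// nnegrE l2norm_ge0. Qed.

Lemma l2norm_pythagoras n (u v : 'cV[R]_n) :
  u^T *m v = 0 -> l2norm (u + v) ^+ 2 = l2norm u ^+ 2 + l2norm v ^+ 2.
Proof.
move=> uv0; have vu0 : v^T *m u = 0 by rewrite -[LHS]trmxK trmx_mul trmxK uv0 trmx0.
by rewrite !l2norm_sqr [(u + v)^T]raddfD mulmxDl !mulmxDr uv0 vu0 addr0 add0r mxE.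
Qed.

Variables (N M : nat) (A : 'M[R]_(N, M)).
Hypothesis gramA : A^T *m A \in unitmx.

Lemma basis_proj_id (y : 'cV[R]_M) : basis_proj A *m (A *m y) = A *m y.
Proof. by rewrite /basis_proj -!mulmxA (mulmxA A^T) mulKmx. Qed.

Lemma basis_proj_orthogonal (b : 'cV[R]_N) :
  A^T *m (b - basis_proj A *m b) = 0.
Proof. by rewrite /basis_proj mulmxBr !mulmxA mulmxV// mul1mx subrr. Qed.

(** [b - A *m y] splits into [b - basis_proj A *m b], which [A^T] annihilates, and a vector in the
    column space of [A]. Only the latter depends on [y], so it alone decides minimality. *)
Lemma l2norm_residual (b : 'cV[R]_N) (y : 'cV[R]_M) :
  l2norm (b - A *m y) ^+ 2
    = l2norm (b - basis_proj A *m b) ^+ 2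
      + l2norm (basis_proj A *m b - A *m y) ^+ 2.
Proof.
rewrite -l2norm_pythagoras; first by rewrite addrA subrK.
have -> : basis_proj A *m b - A *m y
    = A *m (invmx (A^T *m A) *m (A^T *m b) - y).
  by rewrite mulmxBr /basis_proj !mulmxA.
rewrite mulmxA -[X in X *m _]trmxK trmx_mul trmxK basis_proj_orthogonal.
by rewrite trmx0 mul0mx.
Qed.

Lemma l2norm_basis_proj_le (b : 'cV[R]_N) (y : 'cV[R]_M) :
  l2norm (b - basis_proj A *m b) <= l2norm (b - A *m y).
Proof. by rewrite -ler_l2norm_sqr l2norm_residual lerDl sqr_ge0. Qed.

Lemma least_squares_argminP (b : 'cV[R]_N) (x : 'cV[R]_M) :
  is_argmin (fun y => l2norm (b - A *m y)) x <-> A *m x = basis_proj A *m b.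
Proof.
split=> [minx|Ax y]; last by rewrite Ax l2norm_basis_proj_le.
(* The competitor solves the normal equations, so [A] maps it to the projection of [b]. Comparing
   with it forces the second term of [l2norm_residual] to vanish. *)
have := minx (invmx (A^T *m A) *m (A^T *m b)).
have -> : A *m (invmx (A^T *m A) *m (A^T *m b)) = basis_proj A *m b.
  by rewrite /basis_proj !mulmxA.
rewrite -ler_l2norm_sqr l2norm_residual gerDl => /l2norm_eq0/eqP.
by rewrite subr_eq0 => /eqP.
Qed.

End LeastSquares.

Lemma POD_basis_orthonormal (R : realType) (N M Ns : nat)
    (S : 'M[R]_(N, Ns)) (Phi : 'M[R]_(N, M)) :
  is_POD_basis S Phi -> Phi^T *m Phi = 1%:M.
Proof.
move=> [U [Sigma [V [leMN [[UU _ _ _ _] ->]]]]].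
apply/matrixP => i j; have /matrixP/(_ (widen_ord leMN i) (widen_ord leMN j)) := UU.
by rewrite !mxE => eqU; rewrite -[RHS]eqU; apply: eq_bigr => k _; rewrite !mxE.
Qed.

Lemma lspg_objective_ideal (R : realType) (N M : nat)
    (r : 'cV[R]_N -> 'cV[R]_N) (Phi : 'M[R]_(N, M)) (w : 'cV[R]_N)
    (y : 'cV[R]_M) :
  jacobian_mx r w \in unitmx ->
  lspg_objective r Phi (invmx (jacobian_mx r w)) w y
    = l2norm (fom_increment r w - Phi *m y) ^+ 2.
Proof.
move=> Ju; rewrite /lspg_objective /fom_increment -opprD l2normN mulmxDr -mulmxA.
by rewrite mulKmx// addrC.
Qed.

Lemma lspg_argmin_ideal (R : realType) (N M : nat)
    (r : 'cV[R]_N -> 'cV[R]_N) (Phi : 'M[R]_(N, M)) (w : 'cV[R]_N)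
    (x : 'cV[R]_M) :
  Phi^T *m Phi \in unitmx -> jacobian_mx r w \in unitmx ->
  is_argmin (lspg_objective r Phi (invmx (jacobian_mx r w)) w) x
    <-> Phi *m x = basis_proj Phi *m fom_increment r w.
Proof.
move=> gramPhi Ju; rewrite -least_squares_argminP//.
by split=> minx y; have := minx y; rewrite !lspg_objective_ideal// ler_l2norm_sqr.
Qed.

Theorem theorem1 (R : realType) (N M Ns : nat) (S : 'M[R]_(N, Ns))
    (Phi : 'M[R]_(N, M)) (r : 'cV[R]_N -> 'cV[R]_N) (w0 : 'cV[R]_N)
    (hPhi : is_POD_basis S Phi) :
  [/\ (* the inverse in the projection formula is a genuine one *)
      Phi^T *m Phi \in unitmx,

      (* every ideal preconditioned ROM emulates the projection of the FOM
         increment, and hence is the most accurate one for the basis Phi *)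
      forall (K : nat) (P : nat -> 'M[R]_N) (alpha : nat -> R)
             (what dwhat : nat -> 'cV[R]_M),
        lspg_gauss_newton r w0 Phi K P alpha what dwhat ->
        ideal_preconditioning r w0 Phi K P what ->
        forall k : nat, (0 < k <= K)%N ->
          let w := current_iterate w0 Phi what k in
          let dw := fom_increment r w in
          [/\ Phi *m dwhat k = basis_proj Phi *m dw,
              is_argmin (fun y : 'cV[R]_M => l2norm (dw - Phi *m y)) (dwhat k)
            & is_argmin (fun y : 'cV[R]_M =>
                           l2norm (w + alpha k *: dw - rom_state w0 Phi y))
                        (what k)],

      (* the projection bounds from below the error of any ROM increment and
         of any ROM solution *)
      (forall (dw : 'cV[R]_N) (y : 'cV[R]_M),
         l2norm (dw - basis_proj Phi *m dw) <= l2norm (dw - Phi *m y)) /\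
      (forall (w : 'cV[R]_N) (y : 'cV[R]_M),
         l2norm (w - (w0 + basis_proj Phi *m (w - w0)))
           <= l2norm (w - rom_state w0 Phi y))

    & (* such a ROM is realizable through preconditioning, from any initial
         coordinates and for any step lengths, for as long as the FOM Jacobian
         at the iterates exists and is full rank *)
      forall (what0 : 'cV[R]_M) (alpha : nat -> R),
        exists (P : nat -> 'M[R]_N) (what dwhat : nat -> 'cV[R]_M),
          what 0%N = what0 /\
          forall K : nat,
            (forall k : nat, (0 < k <= K)%N ->
               let w := current_iterate w0 Phi what k in
               differentiable r w /\ \rank (jacobian_mx r w) = N) ->
            lspg_gauss_newton r w0 Phi K P alpha what dwhat /\
            ideal_preconditioning r w0 Phi K P what].
Proof.
have gramPhi : Phi^T *m Phi \in unitmx.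
  by rewrite (POD_basis_orthonormal hPhi) unitmx1.
split=> //.
- move=> K P alpha what dwhat gn ideal k kK w dw.
  have [_ _ minP whatk] := gn k kK.
  have [rkJ Pk] := ideal k kK.
  have Ju : jacobian_mx r w \in unitmx by rewrite -row_full_unit /row_full rkJ.
  have proj_dw : Phi *m dwhat k = basis_proj Phi *m dw.
    by apply/lspg_argmin_ideal => //; rewrite -Pk.
  split=> //; first exact/least_squares_argminP.
  (* After cancelling [w0], the target is [Phi *m what k.-1 + alpha k *: dw]. The projection fixes
     its first term, so it sends the target to [Phi *m what k] for any step length. *)
  have argmin_state : is_argmin
      (fun y => l2norm (Phi *m what k.-1 + alpha k *: dw - Phi *m y)) (what k).
    apply/least_squares_argminP => //.
    by rewrite whatk !mulmxDr -!scalemxAr proj_dw basis_proj_id.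
  move=> y; have := argmin_state y.
  have shift z : w + alpha k *: dw - rom_state w0 Phi z
      = Phi *m what k.-1 + alpha k *: dw - Phi *m z.
    by rewrite /w /current_iterate /rom_state opprD addrA (addrAC _ _ (- w0)) (addrAC w0) subrr add0r.
  by rewrite !shift.
- split=> [dw y|w y]; first exact: l2norm_basis_proj_le.
  (* This is the increment bound at [w - w0]. *)
  by rewrite /rom_state !opprD !addrA l2norm_basis_proj_le.
- move=> what0 alpha.
  (* An explicit minimiser: the normal-equation solution for the FOM increment at coordinates
     [y]. *)
  pose d y := invmx (Phi^T *m Phi)
    *m (Phi^T *m fom_increment r (rom_state w0 Phi y)).
  (* The step from [k] to [k.+1] is iteration [k.+1], hence [alpha k.+1]. Since [invmx] is total (it
     returns a singular matrix unchanged), the recursion never stops and one sequence serves every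
     [K]. *)
  pose what := nat_rect (fun=> 'cV[R]_M) what0
    (fun k y => y + alpha k.+1 *: d y).
  exists (fun k => invmx (jacobian_mx r (current_iterate w0 Phi what k))).
  exists what, (fun k => d (what k.-1)).
  split=> // K regular; split=> k kK; have [diff rkJ] := regular k kK; last by [].
  have Ju : jacobian_mx r (current_iterate w0 Phi what k) \in unitmx.
    by rewrite -row_full_unit /row_full rkJ.
  split=> //; first by rewrite unitmx_inv.
    by apply/lspg_argmin_ideal => //; rewrite /basis_proj !mulmxA.
  (* The bounds exclude [k = 0]; at a successor the update holds by computation of [nat_rect]. *)
  by case: k kK {diff rkJ Ju}.
Qed.
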